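(* Let $X\subseteq \mathbb{C}^n$ be an irreducible affine cone which is not a linear subspace. Then \[ X^{*}\subseteq \mathrm{DS}(X)\subseteq X^{*}+\mathrm{Sing}\,X, \] where $X^{*}+\mathrm{Sing}\,X=\{a+b : a\in X^{*},\ b\in \mathrm{Sing}\,X\}$.
   Context: Work over $\mathbb{C}^n$ with the standard symmetric bilinear form $(x|y)=\sum_{i=1}^n x_iy_i$. Let $X\subseteq\mathbb{C}^n$ be an irreducible variety of codimension $c$ with radical defining ideal $I$; $\mathrm{Jac}_x(I)$ is the Jacobian matrix of a generating set of $I$ at $x$. $\mathrm{Sing}\,X$ is the set of $x\in X$ at which all $c\times c$ minors of $\mathrm{Jac}_x(I)$ vanish, and $X^{\mathrm{reg}}=X\setminus \mathrm{Sing}\,X$. The ED correspondence $\mathcal{E}_X\subseteq \mathbb{C}^n_u\times\mathbb{C}^n_x$ is the Zariski closure of the set of pairs $(u,x)$ with $u\in\mathbb{C}^n$, $x\in X^{\mathrm{reg}}$ and $\mathrm{rank}\begin{pmatrix}u-x\\ \mathrm{Jac}_x(I)\end{pmatrix}\le c$ (i.e. $u-x$ is orthogonal, w.r.t. $(\cdot|\cdot)$, to the tangent space $T_xX$; equivalently $x$ is a critical point of $d_u(x)=\sum_i(u_i-x_i)^2$ on $X^{\mathrm{reg}}$). Let $\pi_1,\pi_2$ be the projections of $\mathcal{E}_X$ to the $u$- and $x$-coordinates. The ED data singular locus is $\mathrm{DS}(X)=\pi_1(\mathcal{E}_X\cap\pi_2^{-1}(\mathrm{Sing}\,X))$. The dual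 variety $X^{*}\subseteq\mathbb{C}^n$ is the Zariski closure of the set of $u\in\mathbb{C}^n$ such that $(u|v)=0$ for all $v\in T_xX$ for some $x\in X^{\mathrm{reg}}$ (dual identified with $\mathbb{C}^n$ via $(\cdot|\cdot)$). An affine cone is a variety stable under scaling, i.e. defined by homogeneous polynomials. *)

(* Defs.v *)
From HB Require Import structures.
From mathcomp Require Import all_boot all_order all_algebra.
From mathcomp Require Import reals complex.
From mathcomp Require Import mpoly.
Set Implicit Arguments. Unset Strict Implicit. Unset Printing Implicit Defensive.
Import Order.TTheory GRing.Theory Num.Theory.
Local Open Scope ring_scope.
Local Open Scope complex_scope.

Section AffineGeometry.
Variable R : realType.
Notation C := (R[i]).

Definition evalpt (m : nat) (p : {mpoly C[m]}) (x : 'rV[C]_m) : C :=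
  p.@[fun j => x 0 j].

Definition zeroset (m : nat) (S : {mpoly C[m]} -> Prop) : 'rV[C]_m -> Prop :=
  fun x => forall p, S p -> evalpt p x = 0.

Definition vanishing (m : nat) (A : 'rV[C]_m -> Prop) : {mpoly C[m]} -> Prop :=
  fun p => forall x, A x -> evalpt p x = 0.

Definition zclosed (m : nat) (Y : 'rV[C]_m -> Prop) : Prop :=
  exists S : {mpoly C[m]} -> Prop, forall x, Y x <-> zeroset S x.

Definition zclosure (m : nat) (A : 'rV[C]_m -> Prop) : 'rV[C]_m -> Prop :=
  zeroset (vanishing A).

Definition subset_pts (m : nat) (A B : 'rV[C]_m -> Prop) := forall x, A x -> B x.

Definition irreducible (m : nat) (Y : 'rV[C]_m -> Prop) : Prop :=
  zclosed Y /\ (exists x, Y x) /\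
  forall A B : 'rV[C]_m -> Prop, zclosed A -> zclosed B ->
    subset_pts Y (fun x => A x \/ B x) -> subset_pts Y A \/ subset_pts Y B.

Definition has_chain (m : nat) (X : 'rV[C]_m -> Prop) (k : nat) : Prop :=
  exists Y : nat -> 'rV[C]_m -> Prop,
    (forall i, (i <= k)%N -> irreducible (Y i) /\ subset_pts (Y i) X) /\
    (forall i, (i < k)%N -> subset_pts (Y i) (Y i.+1) /\
                           exists x, Y i.+1 x /\ ~ Y i x).

Definition dimension (m : nat) (X : 'rV[C]_m -> Prop) (d : nat) : Prop :=
  has_chain X d /\ ~ has_chain X d.+1.

Definition gen_ideal (m k : nat) (g : 'I_k -> {mpoly C[m]}) : {mpoly C[m]} -> Prop :=
  fun p => exists a : 'I_k -> {mpoly C[m]}, p = \sum_(i < k) a i * g i.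

Definition generates (m k : nat) (g : 'I_k -> {mpoly C[m]}) (I : {mpoly C[m]} -> Prop) :=
  forall p, I p <-> gen_ideal g p.

Definition jacobian (m k : nat) (g : 'I_k -> {mpoly C[m]}) (x : 'rV[C]_m) : 'M[C]_(k, m) :=
  \matrix_(i < k, j < m) evalpt (mderiv j (g i)) x.

Definition minors_vanish (k m c : nat) (A : 'M[C]_(k, m)) : Prop :=
  forall (f : 'I_c -> 'I_k) (h : 'I_c -> 'I_m),
    \det (\matrix_(i < c, j < c) A (f i) (h j)) = 0.

(* singular locus, w.r.t. codimension c and generating family g *)
Definition Sing (n k c : nat) (X : 'rV[C]_n -> Prop) (g : 'I_k -> {mpoly C[n]})
  (x : 'rV[C]_n) : Prop :=
  X x /\ minors_vanish c (jacobian g x).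

Definition Xreg (n k c : nat) (X : 'rV[C]_n -> Prop) (g : 'I_k -> {mpoly C[n]})
  (x : 'rV[C]_n) : Prop :=
  X x /\ ~ Sing c X g x.

Definition bil (n : nat) (x y : 'rV[C]_n) : C := \sum_(i < n) x 0 i * y 0 i.

Definition tangent (n k : nat) (g : 'I_k -> {mpoly C[n]}) (x v : 'rV[C]_n) : Prop :=
  jacobian g x *m v^T = 0.

(* ED correspondence, as a subset of C^n_u x C^n_x = C^(n+n) (points row_mx u x) *)
Definition ED_corr_pts (n k c : nat) (X : 'rV[C]_n -> Prop) (g : 'I_k -> {mpoly C[n]})
  : 'rV[C]_(n + n) -> Prop :=
  fun z => Xreg c X g (rsubmx z) /\
           (\rank (col_mx (lsubmx z - rsubmx z) (jacobian g (rsubmx z))) <= c)%N.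

Definition ED_corr (n k c : nat) (X : 'rV[C]_n -> Prop) (g : 'I_k -> {mpoly C[n]})
  (u x : 'rV[C]_n) : Prop :=
  zclosure (ED_corr_pts c X g) (row_mx u x).

Definition DS (n k c : nat) (X : 'rV[C]_n -> Prop) (g : 'I_k -> {mpoly C[n]})
  (u : 'rV[C]_n) : Prop :=
  exists x, ED_corr c X g u x /\ Sing c X g x.

Definition dual_variety (n k c : nat) (X : 'rV[C]_n -> Prop) (g : 'I_k -> {mpoly C[n]})
  : 'rV[C]_n -> Prop :=
  zclosure (fun u => exists x, Xreg c X g x /\
                       forall v, tangent g x v -> bil u v = 0).

Definition affine_cone (n : nat) (X : 'rV[C]_n -> Prop) : Prop :=
  forall (t : C) x, X x -> X (t *: x).

Definition linear_subspace (n : nat) (X : 'rV[C]_n -> Prop) : Prop :=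
  X 0 /\ (forall x y, X x -> X y -> X (x + y)) /\ (forall (t : C) x, X x -> X (t *: x)).

End AffineGeometry.

(* Main.v *)
Require Import Defs.
From HB Require Import structures.
From mathcomp Require Import all_boot all_order all_algebra.
From mathcomp Require Import boolp reals complex.
From mathcomp Require Import mpoly ring zify.
Import Order.TTheory GRing.Theory Num.Theory.
Local Open Scope ring_scope.
Local Open Scope complex_scope.

Set Implicit Arguments.
Unset Strict Implicit.
Unset Printing Implicit Defensive.

(** If [u] is conormal to [X] at a regular point [x], then [(u + t x, t x)] lies in
    the ED correspondence for all [t <> 0], because the conormal space is constant
    along the line spanned by [x]; letting [t] tend to [0] gives [(u, 0)].  Conversely
    [(u, x) |-> u - x] maps the ED correspondence into the dual variety.

    What remains is dimension theory: the Jacobian has rank at most [n - d] on [X],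
    and less than that at [0] unless [X] is linear, since [X] lies in the kernel of
    its Jacobian at [0].  Both follow from [rank + e <= n] for the Jacobian of any
    polynomials vanishing on the top of a chain [Y_0 < ... < Y_e].  To see this, pick
    [y_i] vanishing on [Y_i] but not on [Y_(i+1)]; the [y_i] are algebraically
    independent modulo the ideal of [Y_e].  In characteristic [0] each partial
    derivative [d/dy_i] extends, after multiplication by a nonzero [w_i], to the
    coordinate functions, which yields [e] vector fields tangent to [Y_e] that are
    independent wherever no [w_i] vanishes. *)

(** * Derivations along a ring morphism and their extension to polynomials *)

Definition derivation (A B : comNzRingType) (phi delta : A -> B) :=
  forall x y, delta (x * y) = phi x * delta y + phi y * delta x.

Section PolynomialExtension.
Variables (A B : comNzRingType) (phi : {rmorphism A -> B}).
Variables (delta : {additive A -> B}) (b w v : B).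

Definition peval : {rmorphism {poly A} -> B} := horner_eval b \o map_poly phi.

(** For a derivation [delta], this is the derivation over [peval] that extends [w * delta] and sends
    ['X] to [v]. The factor [w] clears the denominator that a value at [b] may need. *)
Definition pext (p : {poly A}) : B := w * (map_poly delta p).[b] + peval p^`() * v.

Fact pext_is_zmod_morphism : zmod_morphism pext.
Proof.
move=> p q; rewrite /pext !raddfB /= hornerD hornerN mulrBr mulrBl.
by rewrite opprD addrACA.
Qed.

HB.instance Definition _ :=
  GRing.isZmodMorphism.Build {poly A} B pext pext_is_zmod_morphism.

Lemma pevalC a : peval a%:P = phi a.
Proof. by rewrite /= horner_evalE map_polyC hornerC. Qed.

Lemma pevalX : peval 'X = b.
Proof. by rewrite /= horner_evalE map_polyX hornerX. Qed.

Lemma pextC a : pext a%:P = w * delta a.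
Proof. by rewrite /pext derivC rmorph0 mul0r addr0 map_polyC hornerC. Qed.

Lemma map_poly_derivation (p q : {poly A}) : derivation phi delta ->
  map_poly delta (p * q)
  = map_poly phi p * map_poly delta q + map_poly phi q * map_poly delta p.
Proof.
move=> dD; apply/polyP=> i.
rewrite coefD coef_map coefM raddf_sum coefM coefMr -big_split /=.
by apply: eq_bigr => j _; rewrite dD !coef_map.
Qed.

Lemma pext_derivation : derivation phi delta -> derivation peval pext.
Proof.
move=> dD p q; rewrite /pext (map_poly_derivation _ _ dD) derivM rmorphD !rmorphM.
rewrite hornerD !hornerM /= !horner_evalE; ring.
Qed.

End PolynomialExtension.

(** * Prime ideals, as predicates standing in for quotient domains *)

Record prime_ideal (B : comNzRingType) (I : B -> Prop) : Prop := PrimeIdeal {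
  ideal0 : I 0;
  idealD : forall x y, I x -> I y -> I (x + y);
  idealM : forall x y, I y -> I (x * y);
  ideal_proper : ~ I 1;
  idealP : forall x y, I (x * y) -> I x \/ I y }.

Section PrimeIdeal.
Variables (B : comNzRingType) (I : B -> Prop) (pI : prime_ideal I).

Lemma idealMr x y : I x -> I (x * y).
Proof. by rewrite mulrC; apply: (idealM pI). Qed.

Lemma idealN x : I x -> I (- x).
Proof. by move=> Ix; rewrite -mulN1r; apply: (idealM pI). Qed.

Lemma idealB x y : I x -> I y -> I (x - y).
Proof. by move=> Ix Iy; apply: (idealD pI) => //; apply: idealN. Qed.

Lemma ideal_sum (T : Type) (r : seq T) (P : pred T) (f : T -> B) :
  (forall i, P i -> I (f i)) -> I (\sum_(i <- r | P i) f i).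
Proof. by move=> If; apply: big_ind => //; [exact: ideal0 pI | exact: idealD pI]. Qed.

Lemma ideal_expr x m : I (x ^+ m) -> I x.
Proof.
elim: m => [/(ideal_proper pI)//|m IH].
by rewrite exprS => /(idealP pI) [].
Qed.

Lemma nideal_prod (T : Type) (r : seq T) (f : T -> B) :
  (forall i, ~ I (f i)) -> ~ I (\prod_(i <- r) f i).
Proof.
move=> If; apply: (big_ind (fun x => ~ I x)) => //; first exact: ideal_proper pI.
by move=> x y Ix Iy /(idealP pI) [].
Qed.

End PrimeIdeal.

(** * Extending a derivation to new elements modulo a prime ideal *)

Section Extension.
Variables (B : comNzRingType) (I : B -> Prop) (pI : prime_ideal I).
Hypothesis char0 : forall m, ~ I m.+1%:R.

Lemma ideal_horner (p : {poly B}) b : (forall i, I p`_i) -> I p.[b].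
Proof.
move=> Ip; rewrite horner_coef; apply: ideal_sum => // i _.
exact: idealMr.
Qed.

Section Step.
Variables (A : idomainType) (phi : {rmorphism A -> B}) (delta : {additive A -> B}).
Variable b : B.
Hypothesis dD : derivation phi delta.
Hypothesis dI : forall a, I (phi a) -> I (delta a).

Let coefI (p : {poly A}) := forall i, I (phi p`_i).

Lemma pext_ideal w v (p : {poly A}) : coefI p -> I (pext phi delta b w v p).
Proof.
move=> Ip; apply: (idealD pI).
  apply: (idealM pI); apply: ideal_horner => i.
  by rewrite coef_map; apply: dI.
apply: idealMr => //; rewrite /= horner_evalE; apply: ideal_horner => i.
by rewrite coef_map coef_deriv raddfMn /= -mulr_natr; apply: idealMr.
Qed.

(* Either [b] is transcendental modulo [I], and [w = 1], [v = 0] will do, or [b]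
   has a minimal equation [q], and then [w] and [v] are read off from
   [q'(b) * delta b + (delta q)(b) = 0]. *)
Lemma derivation_extends : exists w v, ~ I w /\
  forall p : {poly A}, I (peval phi b p) -> I (pext phi delta b w v p).
Proof.
pose alg (p : {poly A}) := I (peval phi b p) /\ ~ coefI p.
have [[p0 algp0]|nalg] := EM (exists p, alg p); last first.
  exists 1, 0; split; first exact: ideal_proper pI.
  move=> p Ip; apply: pext_ideal.
  by apply: contrapT => Np; apply: nalg; exists p.
have exm : exists m, `[< exists2 p, alg p & size p = m >].
  by exists (size p0); apply/asboolP; exists p0.
case: (ex_minnP exm) => m /asboolP [q [Iq Nq] <-] minq.
have small (p : {poly A}) : (size p < size q)%N -> I (peval phi b p) -> coefI p.
  move=> ltpq Ip; apply: contrapT => Np.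
  suff : (size q <= size p)%N by rewrite leqNgt ltpq.
  by apply: minq; apply/asboolP; exists p.
have q0 : q != 0.
  apply: contra_notN Nq => /eqP -> i; rewrite coef0 rmorph0.
  exact: ideal0 pI.
(* Otherwise dropping the leading term leaves a shorter relation, whose coefficients all lie in [I]
   by minimality; then so do those of [q]. *)
have Nlc : ~ I (phi (lead_coef q)).
  move=> Il; pose r := q - lead_coef q *: 'X^((size q).-1).
  have szr : (size r < size q)%N.
    rewrite /r -(prednK (_ : 0 < size q)%N) ?size_poly_gt0 // ltnS.
    apply/leq_sizeP => j lej; rewrite coefB coefZ coefXn.
    move: lej; rewrite leq_eqVlt => /orP [/eqP <-|ltj].
      by rewrite eqxx mulr1 subrr.
    rewrite gtn_eqF // mulr0 subr0 nth_default //.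
    by rewrite -(prednK (_ : 0 < size q)%N) ?size_poly_gt0.
  have Ir : coefI r.
    apply: small => //; rewrite rmorphB -mul_polyC rmorphM pevalC.
    by apply: idealB => //; apply: idealMr.
  apply: Nq => i; have -> : q = r + lead_coef q *: 'X^((size q).-1).
    by rewrite subrK.
  rewrite coefD coefZ rmorphD rmorphM; apply: (idealD pI) => //.
  exact: idealMr.
exists (peval phi b q^`()), (- (map_poly delta q).[b]); split.
  (* The derivative is shorter than [q], so minimality and characteristic 0 put every non-constant
     coefficient of [q] in [I]; the relation at [b] then forces the constant one in as well. *)
  move=> Iq'; have Iq'c := small _ (lt_size_deriv q0) Iq'.
  have IqS i : I (phi q`_i.+1).
    have := Iq'c i; rewrite coef_deriv raddfMn /= -mulr_natr.
    by case/(idealP pI) => // /char0.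
  apply: Nq => -[|i] //.
  have : I (peval phi b (take_poly 1 q + drop_poly 1 q * 'X^1)).
    by rewrite poly_take_drop.
  rewrite rmorphD rmorphM.
  have -> : take_poly 1 q = (q`_0)%:P.
    by apply/polyP => -[|i]; rewrite coef_take_poly coefC.
  rewrite pevalC => Iq2.
  rewrite -[phi _](addrK (peval phi b (drop_poly 1 q) * peval phi b 'X^1)).
  apply: idealB => //; apply: idealMr => //.
  rewrite /= horner_evalE; apply: ideal_horner => i.
  by rewrite coef_map coef_drop_poly addnC; apply: IqS.
set w := peval _ _ _; set v := - _.
have Dq : pext phi delta b w v q = 0 by rewrite /pext -/w mulrN mulrC subrr.
move=> p Ip.
(* [A] is only a domain, so this is pseudo-division: [p] gets multiplied by a power of the leading
   coefficient, which primality removes at the end. *)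
have E := Pdiv.Idomain.divp_eq p q.
have Irem : coefI (p %% q).
  apply: small; first by rewrite Pdiv.Idomain.ltn_modp.
  have -> : p %% q = lead_coef q ^+ scalp p q *: p - p %/ q * q.
    by rewrite E [X in X - _]addrC addrK.
  rewrite rmorphB -mul_polyC !rmorphM.
  by apply: idealB => //; apply: (idealM pI).
pose ev := peval phi b; pose D := pext phi delta b w v.
have DD (x y : {poly A}) : D (x * y) = ev x * D y + ev y * D x.
  exact: pext_derivation.
have DA x y : D (x + y) = D x + D y by exact: raddfD.
have Dp : I (phi (lead_coef q) ^+ scalp p q * pext phi delta b w v p).
  have := congr1 D E.
  rewrite -mul_polyC DD {1}/ev pevalC rmorphXn DA DD (Dq : D q = 0) mulr0 add0r.
  move/(canRL (addrK _)) => ->.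
  apply: idealB => //; last exact: idealMr.
  by apply: (idealD pI); [apply: idealMr | apply: pext_ideal].
by case: (idealP pI Dp) => // /(ideal_expr pI).
Qed.

End Step.
End Extension.

Section ExtensionSeq.
Variables (B : comNzRingType) (I : B -> Prop) (pI : prime_ideal I).
Hypothesis char0 : forall m, ~ I m.+1%:R.

(** [A'] is [A] with one variable adjoined per element of [s], and the denominators of the
    successive steps multiply up to [w]. The condition on [I] is carried along because [phi'] need
    not be injective modulo [I]. *)
Lemma derivation_extends_seq (s : seq B) (A : idomainType)
    (phi : {rmorphism A -> B}) (delta : {additive A -> B}) :
  derivation phi delta -> (forall a, I (phi a) -> I (delta a)) ->
  exists (A' : idomainType) (j : {rmorphism A -> A'})
    (phi' : {rmorphism A' -> B}) (delta' : {additive A' -> B}) (w : B),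
  [/\ ~ I w, derivation phi' delta', forall a, I (phi' a) -> I (delta' a),
      forall a, phi' (j a) = phi a /\ delta' (j a) = w * delta a
    & {in s, forall b, exists t, phi' t = b}].
Proof.
elim: s A phi delta => [|b s IH] A phi delta dD dI.
  exists A, idfun, phi, delta, 1; split=> //; first exact: ideal_proper pI.
  by move=> a /=; rewrite mul1r.
have [w [v [Iw Ipext]]] := derivation_extends pI char0 b dD dI.
have [A' [j [phi' [delta' [w' [Iw' dD' dI' ext onto]]]]]] :=
  IH _ _ _ (pext_derivation b w v dD) Ipext.
exists A', (j \o polyC), phi', delta', (w' * w); split=> //.
- by case/(idealP pI).
- by move=> a; have [] := ext a%:P; rewrite pevalC /= pextC mulrA.
- move=> c; rewrite inE => /predU1P [->|/onto //].
  by exists (j 'X); rewrite (ext _).1 pevalX.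
Qed.

End ExtensionSeq.

(** * The chain rule for derivations on multivariate polynomials *)

Lemma mpoly_ring_ind n (F : comNzRingType) (P : {mpoly F[n]} -> Prop) :
  (forall c, P c%:MP) -> (forall i, P 'X_i) ->
  (forall p q, P p -> P q -> P (p + q)) ->
  (forall p q, P p -> P q -> P (p * q)) -> forall p, P p.
Proof.
move=> PC PX PD PM; elim/mpolyind => [|c m p _ _ Pp]; first by rewrite -mpolyC0.
apply: PD => //; rewrite -mul_mpolyC; apply: (PM) => //.
rewrite mpolyXE_id; apply: (big_ind P); [by rewrite -mpolyC1 | exact: (PM) |].
move=> i _; elim: (m i) => [|k Pk]; last by rewrite exprS; apply: PM.
by rewrite expr0 -mpolyC1.
Qed.

Lemma mderivXU n (F : comNzRingType) (i l : 'I_n) :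
  mderiv l ('X_i : {mpoly F[n]}) = (i == l)%:R.
Proof.
rewrite mderivX mnm1E; case: eqVneq => [->|_]; last by rewrite scale0r.
rewrite scale1r (_ : (U_(l) - U_(l))%MM = 0%MM) ?mpolyX0 //.
by apply/mnmP => k; rewrite mnmBE mnm0E subnn.
Qed.

(** Both sides obey the Leibniz rule in [f], so constants and variables suffice. Besides extended
    derivations, it serves for derivatives along a line and after a rescaling. *)
Lemma derivation_chain_rule n (F A B : comNzRingType)
    (psi : {rmorphism {mpoly F[n]} -> A}) (phi : {rmorphism A -> B})
    (delta : {additive A -> B}) :
  derivation phi delta -> (forall c, delta (psi c%:MP) = 0) ->
  forall f, delta (psi f) = \sum_(l < n) phi (psi (mderiv l f)) * delta (psi 'X_l).
Proof.
move=> dD dC; elim/mpoly_ring_ind => [c|i|p q IHp IHq|p q IHp IHq].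
- by rewrite dC big1 // => l _; rewrite mderivC !rmorph0 mul0r.
- rewrite (bigD1 i) //= big1 => [|l li]; rewrite mderivXU.
    by rewrite eqxx !rmorph1 mul1r addr0.
  by rewrite eq_sym (negPf li) !rmorph0 mul0r.
- by rewrite !rmorphD raddfD IHp IHq -big_split; apply: eq_bigr => l _;
    rewrite mderivD !rmorphD mulrDl.
- rewrite rmorphM dD IHp IHq !mulr_sumr -big_split; apply: eq_bigr => l _.
  by rewrite mderivM !(rmorphD, rmorphM) /=; ring.
Qed.

(** * Tangent vector fields from derivations *)

Section Tangent.
Variables (n : nat) (F : fieldType) (I : {mpoly F[n]} -> Prop) (pI : prime_ideal I).
Hypothesis char0 : forall m, ~ I m.+1%:R.
Variables (A : idomainType) (cst : {rmorphism F -> A}).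
Variables (phi : {rmorphism A -> {mpoly F[n]}}).
Variables (delta : {additive A -> {mpoly F[n]}}).
Hypothesis phi_cst : forall c, phi (cst c) = c%:MP.
Hypothesis delta_cst : forall c, delta (cst c) = 0.
Hypothesis dD : derivation phi delta.
Hypothesis dI : forall a, I (phi a) -> I (delta a).

(** Extending [delta] to the coordinate functions gives the components of a vector field [v]. The
    case [a = 0] says that [v] preserves [I], that is, it is tangent to the zero set; other [a]
    serve to compute its values. *)
Lemma tangent_of_derivation : exists (w : {mpoly F[n]}) (v : 'I_n -> {mpoly F[n]}),
  ~ I w /\ forall a f, I (f - phi a) ->
    I (\sum_(l < n) mderiv l f * v l - w * delta a).
Proof.
have [A' [j [phi' [delta' [w [Iw dD' dI' ext onto]]]]]] :=
  derivation_extends_seq pI char0 [seq 'X_i | i <- enum 'I_n] dD dI.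
have /fin_all_exists [t tE] : forall i : 'I_n, exists t, phi' t = 'X_i.
  by move=> i; apply: onto; apply/mapP; exists i; rewrite ?mem_enum.
(* [psi] lifts polynomials to [A'] and is a section of [phi'], so congruences modulo [I] can be fed
   to [delta']. *)
pose psi : {rmorphism {mpoly F[n]} -> A'} := mmap (j \o cst) t.
have psiC c : psi c%:MP = j (cst c) by rewrite /psi /= mmapC.
have psiX i : psi 'X_i = t i by rewrite /psi /= mmapX mmap1U.
have phipsi f : phi' (psi f) = f.
  elim/mpoly_ring_ind: f => [c|i|p q|p q].
  - by rewrite psiC (ext _).1.
  - by rewrite psiX.
  - by rewrite !rmorphD => -> ->.
  - by rewrite !rmorphM => -> ->.
exists w, (fun l => delta' (t l)); split=> // a f If.
have := dI' (psi f - j a); rewrite rmorphB phipsi (ext _).1 => /(_ If).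
rewrite raddfB (ext _).2 (derivation_chain_rule dD') => [|c]; last first.
  by rewrite psiC (ext _).2 delta_cst mulr0.
by under eq_bigr do rewrite phipsi psiX.
Qed.

End Tangent.

(** * Algebraic independence along an inclusion of primes *)

(** Modulo [I] only the constant term of [p] at [y] survives, so it is zero because [A] embeds
    modulo [I]. Then [y] can be cancelled modulo [J], and the size of [p] drops. *)
Lemma peval_injective (A : idomainType) (B : comNzRingType) (I J : B -> Prop)
    (phi : {rmorphism A -> B}) y :
  prime_ideal I -> prime_ideal J -> (forall x, J x -> I x) -> I y -> ~ J y ->
  (forall a, I (phi a) -> a = 0) -> forall p, J (peval phi y p) -> p = 0.
Proof.
move=> pI pJ JI Iy Jy inj p; move: {2}(size p) (leqnn (size p)) => m.
elim: m p => [p /size_poly_leq0P // |m IH p szp Jp].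
have pE : p = (p`_0)%:P + drop_poly 1 p * 'X.
  rewrite -[LHS](poly_take_drop 1); congr (_ + _).
  by apply/polyP => -[|i]; rewrite coef_take_poly coefC.
have p0 : p`_0 = 0.
  apply: inj; have := JI _ Jp; rewrite {1}pE rmorphD rmorphM pevalC pevalX => Ip.
  rewrite -[phi _](addrK (peval phi y (drop_poly 1 p) * y)).
  by apply: (idealB pI) => //; apply: (idealM pI).
rewrite p0 add0r in pE.
(* Rewriting with this conditional equality leaves first [0 = 0], then its condition, to which the
   induction hypothesis applies. *)
have -> : drop_poly 1 p = 0 -> p = 0 by rewrite {2}pE => ->; rewrite mul0r.
  by [].
apply: IH; first by rewrite size_drop_poly leq_subLR add1n.
by move: Jp; rewrite {1}pE rmorphM pevalX => /(idealP pJ) [].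
Qed.

(** * Rank and minors *)

Lemma nonzero_minor (F : fieldType) m n (A : 'M[F]_(m, n)) :
  exists (f : 'I_(\rank A) -> 'I_m) (h : 'I_(\rank A) -> 'I_n),
    \det (\matrix_(i, j) A (f i) (h j)) != 0.
Proof.
have full : row_full (rowsub (maxrankfun A) A)^T.
  by rewrite /row_full mxrank_tr; apply: maxrowsub_free.
exists (maxrankfun A), (fullrankfun full).
have := fullrowsub_unit full; rewrite unitmxE unitfE -det_tr.
by congr (\det _ != 0); apply/matrixP => i j; rewrite !mxE.
Qed.

Lemma minor_rank (F : fieldType) m n c (A : 'M[F]_(m, n))
    (f : 'I_c -> 'I_m) (h : 'I_c -> 'I_n) :
  \det (\matrix_(i, j) A (f i) (h j)) != 0 -> (c <= \rank A)%N.
Proof.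
move=> det0; set M := \matrix_(i, j) _ in det0.
have <- : \rank M = c by apply/eqP; rewrite -/(row_full _) row_full_unit unitmxE unitfE.
have -> : M = (rowsub h (rowsub f A)^T)^T by apply/matrixP => i j; rewrite !mxE.
rewrite mxrank_tr (leq_trans (mxrankS (rowsub_sub _ _))) // mxrank_tr.
exact: mxrankS (rowsub_sub _ _).
Qed.

(** * Chains of irreducible sets and the rank bound *)

Section Chains.
Variable R : realType.
Notation C := (R[i]).

Lemma vanishing0 n (Y : 'rV[C]_n -> Prop) : vanishing Y 0.
Proof. by move=> x _; rewrite /evalpt meval0. Qed.

Lemma vanishing_prime n (Y : 'rV[C]_n -> Prop) :
  irreducible Y -> prime_ideal (vanishing Y).
Proof.
move=> [_ [[y0 Yy0] irr]]; split; first exact: vanishing0.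
- by move=> p q Ip Iq x Yx; rewrite /evalpt mevalD [_.@[_]]Ip // [_.@[_]]Iq // addr0.
- by move=> p q Iq x Yx; rewrite /evalpt mevalM [X in _ * X]Iq // mulr0.
- by move/(_ _ Yy0)/eqP; rewrite /evalpt meval1 oner_eq0.
- move=> p q Ipq.
  have cl (f : {mpoly C[n]}) : zclosed (fun x => evalpt f x = 0).
    exists (fun f' => f' = f) => x; split=> [fx _ ->|] //.
    exact.
  case: (irr _ _ (cl p) (cl q)) => [x Yx|Yp|Yq]; [|by left|by right].
  have /eqP := Ipq x Yx; rewrite /evalpt mevalM mulf_eq0.
  by case/orP => /eqP; [left|right].
Qed.

Lemma vanishing_char0 n (Y : 'rV[C]_n -> Prop) m :
  irreducible Y -> ~ vanishing Y m.+1%:R.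
Proof.
move=> [_ [[y0 Yy0] _]] /(_ _ Yy0)/eqP.
by rewrite /evalpt -mpolyC_nat mevalC pnatr_eq0.
Qed.

Lemma separating_poly n (Y : 'rV[C]_n -> Prop) x : zclosed Y -> ~ Y x ->
  exists2 p, vanishing Y p & evalpt p x <> 0.
Proof.
move=> [S YS] NYx; apply: contrapT => Np; apply: NYx; apply/YS => p Sp.
apply: contrapT => px; apply: Np; exists p => // y Yy.
by have /YS := Yy; apply.
Qed.

(** [A] is a polynomial ring over [C] in [e] variables [t i], and [delta i] is the partial
    derivative in [t i] followed by [phi]. Each link of the chain adjoins one variable by
    [peval_injective]. *)
Lemma chain_alg_independent n (Y : nat -> 'rV[C]_n -> Prop) e :
  (forall i, (i <= e)%N -> irreducible (Y i)) ->
  (forall i, (i < e)%N -> subset_pts (Y i) (Y i.+1) /\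
                          exists x, Y i.+1 x /\ ~ Y i x) ->
  exists (A : idomainType) (cst : {rmorphism C -> A})
    (phi : {rmorphism A -> {mpoly C[n]}}) (t : nat -> A)
    (delta : nat -> {additive A -> {mpoly C[n]}}),
  [/\ forall c, phi (cst c) = c%:MP,
      forall a, vanishing (Y e) (phi a) -> a = 0,
      forall i, derivation phi (delta i),
      forall i c, delta i (cst c) = 0
    & forall i j, (i < e)%N -> (j < e)%N -> delta i (t j) = (i == j)%:R].
Proof.
elim: e => [|e IH] irr strict.
  exists C, idfun, (@mpolyC n C), (fun=> 0), (fun=> \0); split=> //.
  - move=> c; have [_ [[y Yy] _]] := irr 0%N isT.
    by move/(_ _ Yy); rewrite /evalpt mevalC.
  - by move=> i x y /=; rewrite !mulr0 addr0.
have [|i ltie|A [cst [phi [t [delta [phiC inj dD dC dt]]]]]] := IH.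
- by move=> i lei; apply: irr; apply: leqW.
- by apply: strict; apply: leqW.
have [sub [x [Yx NYx]]] := strict e (ltnSn e).
have [y Iy yx] := separating_poly (irr e (leqnSn e)).1 NYx.
(* The derivative in the new variable has [w = 0] and [v = 1]; the older ones act on coefficients
   and kill the new variable. *)
pose D i : {additive {poly A} -> {mpoly C[n]}} :=
  if i == e then (pext phi \0 y 0 1 : {additive {poly A} -> {mpoly C[n]}})
  else pext phi (delta i) y 1 0.
exists {poly A}, (polyC \o cst), (peval phi y),
  (fun i => if i == e then 'X else (t i)%:P), D.
split; rewrite ?/D.
- by move=> c; rewrite -phiC; apply: pevalC.
- apply: (peval_injective (I := vanishing (Y e)) _ _ _ Iy) => //.
  + exact: vanishing_prime (irr _ _).
  + exact: vanishing_prime (irr _ _).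
  + by move=> p Ip z Yz; apply: Ip; apply: sub.
  + by move/(_ _ Yx).
- move=> i; case: ifP => _; apply: pext_derivation => //.
  by move=> a b /=; rewrite !mulr0 addr0.
- by move=> i c; case: ifP => _; rewrite [LHS]pextC ?dC mulr0.
- move=> i j; rewrite !ltnS => lei lej.
  case: (eqVneq i e) => [->|ie]; case: (eqVneq j e) => [ej|je].
  + by rewrite /= /pext mul0r derivX rmorph1 mul1r add0r.
  + by rewrite [LHS]pextC mul0r.
  + rewrite /= /pext mulr0 addr0 mul1r ej (negPf ie).
    suff -> : map_poly (delta i) 'X = 0 by rewrite horner0.
    apply/polyP => l; rewrite coef_map coefX coef0.
    by case: (l == 1)%N; rewrite ?raddf0 // -(rmorph1 cst) dC.
  + by rewrite [LHS]pextC mul1r dt // ltn_neqAle ?ie ?je.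
Qed.

Lemma chain_rank n (Y : nat -> 'rV[C]_n -> Prop) e k (f : 'I_k -> {mpoly C[n]}) x0 :
  (forall i, (i <= e)%N -> irreducible (Y i)) ->
  (forall i, (i < e)%N -> subset_pts (Y i) (Y i.+1) /\
                          exists x, Y i.+1 x /\ ~ Y i x) ->
  (forall i, vanishing (Y e) (f i)) -> Y e x0 ->
  (\rank (jacobian f x0) + e <= n)%N.
Proof.
move=> irr strict fY Yx0.
have irrY := irr e (leqnn e); have pI := vanishing_prime irrY.
have [A [cst [phi [t [delta [phiC inj dD dC dt]]]]]] :=
  chain_alg_independent irr strict.
have dI i a : vanishing (Y e) (phi a) -> vanishing (Y e) (delta i a).
  by move/inj ->; rewrite raddf0; apply: vanishing0.
have /fin_all_exists [w /fin_all_exists [v wv]] : forall i : 'I_e,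
    exists (w : {mpoly C[n]}) (v : 'I_n -> {mpoly C[n]}), ~ vanishing (Y e) w /\
    forall a p, vanishing (Y e) (p - phi a) ->
    vanishing (Y e) (\sum_(l < n) mderiv l p * v l - w * delta i a).
  move=> i; apply: (tangent_of_derivation pI) => //.
    by move=> m; apply: vanishing_char0.
  exact: dI.
have [s [h minor0]] := nonzero_minor (jacobian f x0).
(* The point [x0] may be a zero of some [w i]. Primality provides a point [x] where neither this
   minor nor any [w i] vanishes; the rank at [x] is at least that at [x0]. *)
pose D := \det (\matrix_(i, j) mderiv (h j) (f (s i))).
have DE x : evalpt D x = \det (\matrix_(i, j) jacobian f x (s i) (h j)).
  by rewrite /evalpt /D -det_map_mx; congr (\det _); apply/matrixP => i j; rewrite !mxE.
have ND : ~ vanishing (Y e) D.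
  by move/(_ _ Yx0)/eqP; rewrite DE (negPf minor0).
have NDw : ~ vanishing (Y e) (D * \prod_(i < e) w i).
  case/(idealP pI) => // /(nideal_prod pI); apply.
  by move=> i; case: (wv i).
have [x Yx] : exists2 x, Y e x & evalpt (D * \prod_(i < e) w i) x != 0.
  apply: contrapT => Nx; apply: NDw => x Yx; apply/eqP; apply: contrapT => /negP Dx.
  by apply: Nx; exists x.
rewrite /evalpt mevalM rmorph_prod mulf_eq0 negb_or => /andP [Dx /prodf_neq0 wx].
have rk : (\rank (jacobian f x0) <= \rank (jacobian f x))%N.
  by apply: (minor_rank (f := s) (h := h)); rewrite -DE.
(* The columns of [V] are the vector fields at [x]. They lie in the kernel of the Jacobian, and
   pairing them with the gradients of the [phi (t i)] gives an invertible diagonal matrix. *)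
pose V := \matrix_(l < n, j < e) evalpt (v j l) x.
have pair (p : {mpoly C[n]}) (j : 'I_e) a : vanishing (Y e) (p - phi a) ->
    \sum_(l < n) evalpt (mderiv l p) x * V l j = evalpt (w j) x * evalpt (delta j a) x.
  move=> Ip; have := (wv j).2 a p Ip x Yx.
  rewrite /evalpt mevalB mevalM rmorph_sum => /eqP; rewrite subr_eq0 => /eqP <-.
  by apply: eq_bigr => l _; rewrite mxE rmorphM.
have JV : jacobian f x *m V = 0.
  apply/matrixP => i j; rewrite !mxE; under eq_bigr do rewrite mxE.
  rewrite (pair _ _ 0); last by rewrite raddf0 subr0; apply: fY.
  by rewrite raddf0 /evalpt meval0 mulr0.
have rV : \rank V = e.
  apply/eqP; rewrite -/(row_full V) -col_leq_rank.
  pose G := \matrix_(i < e, l < n) evalpt (mderiv l (phi (t i))) x.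
  have GV : G *m V = diag_mx (\row_j evalpt (w j) x).
    apply/matrixP => i j; rewrite !mxE; under eq_bigr do rewrite mxE.
    rewrite (pair _ _ (t i)) ?subrr; last exact: vanishing0.
    rewrite dt // (_ : (j == i :> nat) = (i == j)); last by rewrite eq_sym.
    case: eqVneq => [->|_].
      by rewrite /evalpt meval1 mulr1.
    by rewrite /evalpt meval0 mulr0.
  have unit : G *m V \in unitmx.
    rewrite GV unitmxE det_diag unitfE; apply/prodf_neq0 => i _.
    by rewrite mxE; apply: wx.
  by rewrite -{1}(mxrank_unit unit) mxrankM_maxr.
by rewrite -[X in (_ + X <= _)%N]rV (leq_trans _ (mulmx0_rank_max JV)) // leq_add2r.
Qed.
End Chains.

(** * Zariski closure, polynomial maps and restriction to lines *)

Section Geometry.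
Variable R : realType.
Notation C := (R[i]).

Lemma evalpt_comp m n (p : {mpoly C[n]}) (T : n.-tuple {mpoly C[m]}) x :
  evalpt (p \mPo T) x = evalpt p (\row_i evalpt (tnth T i) x).
Proof.
by rewrite /evalpt comp_mpoly_meval; apply: meval_eq => i; rewrite mxE.
Qed.

Lemma zclosure_image m n (T : n.-tuple {mpoly C[m]}) (A : 'rV[C]_m -> Prop)
    (A' : 'rV[C]_n -> Prop) z :
  (forall x, A x -> zclosure A' (\row_i evalpt (tnth T i) x)) ->
  zclosure A z -> zclosure A' (\row_i evalpt (tnth T i) z).
Proof.
move=> AA' Az p pA'; rewrite -evalpt_comp; apply: Az => x Ax.
by rewrite evalpt_comp; apply: AA'.
Qed.

Definition on_line n (a b : 'rV[C]_n) : {rmorphism {mpoly C[n]} -> {poly C}} :=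
  mmap (@polyC C) (fun l => (a 0 l)%:P + b 0 l *: 'X).

Lemma on_lineC n (a b : 'rV[C]_n) c : on_line a b c%:MP = c%:P.
Proof. by rewrite /on_line /= mmapC. Qed.

Lemma on_lineX n (a b : 'rV[C]_n) l : on_line a b 'X_l = (a 0 l)%:P + b 0 l *: 'X.
Proof. by rewrite /on_line /= mmapX mmap1U. Qed.

Lemma horner_on_line n (a b : 'rV[C]_n) p t :
  (on_line a b p).[t] = evalpt p (a + t *: b).
Proof.
elim/mpoly_ring_ind: p => [c|l|p q IHp IHq|p q IHp IHq].
- by rewrite on_lineC hornerC /evalpt mevalC.
- by rewrite on_lineX /evalpt mevalXU !hornerE !mxE mulrC.
- by rewrite rmorphD hornerD IHp IHq /evalpt mevalD.
- by rewrite rmorphM hornerM IHp IHq /evalpt mevalM.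
Qed.

Lemma poly_eq0_pointwise (q : {poly C}) : (forall t, t != 0 -> q.[t] = 0) -> q = 0.
Proof.
move=> q0; apply/eqP; apply: contraT => nq0.
pose s := [seq m.+1%:R : C | m <- iota 0 (size q)].
have us : uniq s.
  by rewrite map_inj_uniq ?iota_uniq // => i j /eqP; rewrite eqr_nat => /eqP [].
have rs : all (root q) s.
  by apply/allP => _ /mapP [m _ ->]; apply/rootP/q0; rewrite pnatr_eq0.
by have := max_poly_roots nq0 rs us; rewrite size_map size_iota ltnn.
Qed.

(** Restricted to the line, an equation of [A] is a univariate polynomial that vanishes away from
    [0], hence also at [0]. *)
Lemma zclosure_limit n (A : 'rV[C]_n -> Prop) a b :
  (forall t, t != 0 -> A (a + t *: b)) -> zclosure A a.
Proof.
move=> Ab p pA; have := horner_on_line a b p 0.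
rewrite scale0r addr0 => <-; rewrite (@poly_eq0_pointwise (on_line a b p)) ?horner0 //.
by move=> t t0; rewrite horner_on_line; apply: pA; apply: Ab.
Qed.

(** * Jacobians of a cone *)

(** Each [g i] vanishes on the whole line through [0] and [x]; its derivative along that line at [0]
    is the entry in question. *)
Lemma jacobian_tangent0 n k (X : 'rV[C]_n -> Prop) (g : 'I_k -> {mpoly C[n]}) x :
  affine_cone X -> (forall i, vanishing X (g i)) -> X x -> tangent g 0 x.
Proof.
move=> cone gX Xx; apply/matrixP => i j; rewrite {j}ord1 !mxE.
have : on_line 0 x (g i) = 0.
  by apply: poly_eq0_pointwise => t _; rewrite horner_on_line add0r; apply: gX; apply: cone.
have dD : derivation (@idfun {poly C}) (@deriv C).
  by move=> p q; rewrite derivM addrC [_ * q]mulrC.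
move/(congr1 (fun p => p^`().[0])).
rewrite deriv0 horner0 (derivation_chain_rule (phi := idfun) dD); last first.
  by move=> c; rewrite on_lineC; apply: derivC.
rewrite horner_sum => E; apply: etrans E; apply: eq_bigr => l _.
rewrite !mxE /= on_lineX derivD derivC add0r derivZ derivX alg_polyC hornerM hornerC.
by rewrite horner_on_line scale0r addr0.
Qed.

Lemma generators_vanish n k (g : 'I_k -> {mpoly C[n]}) I i :
  generates g I -> I (g i).
Proof.
move=> gI; apply/gI; exists (fun j => (i == j)%:R).
rewrite (bigD1 i) //= eqxx mul1r big1 ?addr0 // => j ji.
by rewrite eq_sym (negPf ji) mul0r.
Qed.

Lemma gradient_sub n k (X : 'rV[C]_n -> Prop) (g : 'I_k -> {mpoly C[n]}) x f :
  generates g (vanishing X) -> X x -> vanishing X f ->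
  (\row_j evalpt (mderiv j f) x <= jacobian g x)%MS.
Proof.
move=> gen Xx /gen [a ->]; apply/submxP; exists (\row_i evalpt (a i) x).
apply/rowP => j; rewrite !mxE (raddf_sum (mderiv j)) /evalpt rmorph_sum.
apply: eq_bigr => i _; rewrite !mxE /= mderivM mevalD !mevalM.
by rewrite [X in _ * X + _](generators_vanish i gen _ Xx) mulr0 add0r.
Qed.

(** Precomposed with scaling by [t], [g i] still vanishes on the cone, so [gradient_sub] applies at
    [x]; the gradient there is [t] times that of [g i] at [t *: x]. *)
Lemma jacobian_scale_sub n k (X : 'rV[C]_n -> Prop) (g : 'I_k -> {mpoly C[n]}) x t :
  generates g (vanishing X) -> affine_cone X -> X x -> t != 0 ->
  (jacobian g (t *: x) <= jacobian g x)%MS.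
Proof.
move=> gen cone Xx t0; apply/row_subP => i.
pose T : n.-tuple {mpoly C[n]} := [tuple t *: 'X_l | l < n].
have TE y : \row_l evalpt (tnth T l) y = t *: y.
  by apply/rowP => l; rewrite !mxE tnth_mktuple /evalpt mevalZ mevalXU.
have If : vanishing X (g i \mPo T).
  by move=> y Xy; rewrite evalpt_comp TE; apply: (generators_vanish i gen); apply: cone.
suff -> : row i (jacobian g (t *: x)) = t^-1 *: \row_j evalpt (mderiv j (g i \mPo T)) x.
  by apply: scalemx_sub; apply: gradient_sub If.
apply/rowP => j; rewrite !mxE.
have dD : derivation (@idfun {mpoly C[n]}) (mderiv j).
  by move=> p q; rewrite mderivM addrC [_ * q]mulrC.
rewrite (derivation_chain_rule (psi := comp_mpoly T) (phi := idfun) dD); last first.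
  by move=> c; rewrite /= comp_mpolyC mderivC.
have psiX l : 'X_l \mPo T = t *: 'X_l by rewrite comp_mpolyXU -tnth_nth tnth_mktuple.
rewrite (bigD1 j) //= big1 => [|l lj]; rewrite psiX mderivZ mderivXU.
  by rewrite eqxx addr0 -mul_mpolyC mulr1 /evalpt mevalM mevalC -/(evalpt _ x)
    evalpt_comp TE mulrC mulfK.
by rewrite (negPf lj) scaler0 mulr0.
Qed.

(** Double orthogonality: the columns of the cokernel matrix are tangent vectors, and being
    orthogonal to them characterises the row space. *)
Lemma orthogonal_tangentP n k (g : 'I_k -> {mpoly C[n]}) x u :
  (forall v, tangent g x v -> bil u v = 0) <-> (u <= jacobian g x)%MS.
Proof.
have bilE v : bil u v = (u *m v^T) 0 0.
  by rewrite mxE; apply: eq_bigr => l _; rewrite mxE.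
split=> [orth|/submxP [D ->] v tv]; last first.
  have -> : bil (D *m jacobian g x) v = (D *m jacobian g x *m v^T) 0 0.
    by rewrite mxE; apply: eq_bigr => l _; rewrite [X in _ = _ * X]mxE.
  by rewrite -mulmxA tv mulmx0 mxE.
rewrite submxE; apply/eqP/rowP => j.
pose v := (col j (cokermx (jacobian g x)))^T.
have : bil u v = 0.
  by apply: orth; rewrite /tangent trmxK colE mulmxA mulmx_coker mul0mx.
by rewrite bilE trmxK colE mulmxA -colE mxE => ->; rewrite mxE.
Qed.

(** The top of the given chain may be smaller than [X]; replacing it by [X] keeps the chain strict
    and makes [chain_rank] available at every point of [X]. *)
Lemma jacobian_rank_chain n (X : 'rV[C]_n -> Prop) d k (f : 'I_k -> {mpoly C[n]}) x :
  irreducible X -> has_chain X d -> (forall i, vanishing X (f i)) -> X x ->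
  (\rank (jacobian f x) + d <= n)%N.
Proof.
move=> irrX [Y [irrY strict]] fX Xx.
apply: (chain_rank (Y := fun i => if (i < d)%N then Y i else X)); rewrite ?ltnn //.
  by move=> i lei; case: ifP => // _; case: (irrY i lei).
move=> i ltid; rewrite ltid; have [sub [y [Yy NYy]]] := strict i ltid.
case: ifP => _; first by split=> //; exists y.
have YX := (irrY _ ltid).2.
by split=> [z Yz|]; [apply: YX; apply: sub | exists y; split=> //; apply: YX].
Qed.

(** * Kernels of matrices as varieties, and the singularity of the origin *)

Definition linear_forms n k (J : 'M[C]_(k, n)) (i : 'I_k) : {mpoly C[n]} :=
  \sum_j J i j *: 'X_j.

Lemma evalpt_linear_forms n k (J : 'M[C]_(k, n)) i x :
  evalpt (linear_forms J i) x = (J *m x^T) i 0.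
Proof.
rewrite /evalpt /linear_forms rmorph_sum !mxE.
by apply: eq_bigr => j _; rewrite /= mevalZ mevalXU mxE.
Qed.

Lemma jacobian_linear_forms n k (J : 'M[C]_(k, n)) x : jacobian (linear_forms J) x = J.
Proof.
apply/matrixP => i j; rewrite mxE /linear_forms (raddf_sum (mderiv j)) /evalpt rmorph_sum.
rewrite (bigD1 j) //= big1 => [|l lj]; rewrite mderivZ mderivXU mevalZ.
  by rewrite eqxx meval1 mulr1 addr0.
by rewrite (negPf lj) meval0 mulr0.
Qed.

Lemma linear_forms_vanish n k (J : 'M[C]_(k, n)) i :
  vanishing (fun x => J *m x^T = 0) (linear_forms J i).
Proof. by move=> x Jx; rewrite evalpt_linear_forms Jx mxE. Qed.

(** For kernel points [a] outside [A] and [b] outside [B], the product of separating polynomials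
    vanishes on the line joining them. One factor then does, against its value at [t = 0] or
    [t = 1]. *)
Lemma kernel_irreducible n k (J : 'M[C]_(k, n)) :
  irreducible (fun x => J *m x^T = 0).
Proof.
split; [|split].
- exists (fun p => exists i, p = linear_forms J i) => x; split=> [Jx _ [i ->]|Jx].
    exact: linear_forms_vanish.
  apply/matrixP => i j; rewrite ord1 -evalpt_linear_forms mxE.
  by apply: Jx; exists i.
- by exists 0; rewrite trmx0 mulmx0.
move=> A B clA clB LAB; apply: contrapT => /not_orP [NA NB].
have [a La NAa] : exists2 a, J *m a^T = 0 & ~ A a.
  by apply: contrapT => Nex; apply: NA => a La; apply: contrapT => NAa; apply: Nex; exists a.
have [b Lb NBb] : exists2 b, J *m b^T = 0 & ~ B b.
  by apply: contrapT => Nex; apply: NB => b Lb; apply: contrapT => NBb; apply: Nex; exists b.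
have [p pA pa] := separating_poly clA NAa.
have [q qB qb] := separating_poly clB NBb.
have : on_line a (b - a) (p * q) = 0.
  apply: poly_eq0_pointwise => t _; rewrite rmorphM hornerM !horner_on_line.
  have : J *m (a + t *: (b - a))^T = 0.
    rewrite linearD linearZ /= raddfB mulmxDr -scalemxAr mulmxBr.
    by rewrite La Lb subrr scaler0 addr0.
  by case/LAB => [/pA ->|/qB ->]; rewrite (mul0r, mulr0).
move/eqP; rewrite rmorphM mulf_eq0 => /orP [] /eqP E.
  by apply: pa; rewrite -[a](addr0) -(scale0r (b - a)) -horner_on_line E horner0.
by apply: qb; rewrite -[b](subrK a) addrC -[b - a]scale1r -horner_on_line E horner0.
Qed.

Lemma minors_vanishPn n k c (A : 'M[C]_(k, n)) :
  ~ minors_vanish c A -> (c <= \rank A)%N.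
Proof.
move=> NA; rewrite leqNgt; apply/negP => ltr; apply: NA => f h.
apply/eqP; apply: contraLR ltr; rewrite -leqNgt; exact: minor_rank.
Qed.

(** The kernel [L] of the Jacobian at [0] contains [X] properly, since [X] is not linear, and so
    tops a chain of length [d.+1]. The rank bound, applied to [L] and its linear equations,
    contradicts a rank of at least [n - d]. *)
Lemma zero_singular n (X : 'rV[C]_n -> Prop) d k (g : 'I_k -> {mpoly C[n]}) :
  irreducible X -> dimension X d -> generates g (vanishing X) ->
  affine_cone X -> ~ linear_subspace X -> Sing (n - d) X g 0.
Proof.
move=> irrX [[Y [irrY strict]] _] gen cone nlin.
have X0 : X 0 by have [_ [[x Xx] _]] := irrX; rewrite -(scale0r x); apply: cone.
split=> //; apply: contrapT => /minors_vanishPn rkJ.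
pose J := jacobian g 0; pose L (x : 'rV[C]_n) := J *m x^T = 0.
have XL : subset_pts X L.
  move=> x; apply: (jacobian_tangent0 cone) => i.
  exact: generators_vanish.
have [z Lz NXz] : exists2 z, L z & ~ X z.
  apply: contrapT => Nex; apply: nlin.
  have LX x : L x -> X x by move=> Lx; apply: contrapT => NX; apply: Nex; exists x.
  split=> //; split=> [x y /XL Lx /XL Ly|t x]; last exact: cone.
  by apply: LX; rewrite /L linearD /= mulmxDr Lx Ly addr0.
have chainL : has_chain L d.+1.
  exists (fun i => if (i <= d)%N then Y i else L); split=> i.
    move=> _; case: leqP => [lei|_]; last by split=> //; apply: kernel_irreducible.
    by have [? YX] := irrY i lei; split=> // x Yx; apply: XL; apply: YX.
  rewrite ltnS => lei; rewrite lei; case: ltnP => [ltid|ged]; first exact: strict.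
  have YX := (irrY i lei).2.
  split=> [x Yx|]; first by apply: XL; apply: YX.
  by exists z; split=> // /YX.
have := jacobian_rank_chain (kernel_irreducible J) chainL (linear_forms_vanish (J := J)) (XL 0 X0).
rewrite jacobian_linear_forms /J; move: rkJ; set r := \rank _; lia.
Qed.

(** * Conormal vectors and the ED correspondence *)

Definition conormal_pts n c k (X : 'rV[C]_n -> Prop) (g : 'I_k -> {mpoly C[n]}) u :=
  exists x, Xreg c X g x /\ forall v, tangent g x v -> bil u v = 0.

Lemma reg_rank n (X : 'rV[C]_n -> Prop) k (g : 'I_k -> {mpoly C[n]}) c x :
  Xreg c X g x -> (c <= \rank (jacobian g x))%N.
Proof. by move=> [Xx NS]; apply: minors_vanishPn => m; apply: NS. Qed.

Lemma rank_reg n (X : 'rV[C]_n -> Prop) k (g : 'I_k -> {mpoly C[n]}) c x :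
  X x -> \rank (jacobian g x) = c -> Xreg c X g x.
Proof.
move=> Xx rk; split=> // -[_]; have := nonzero_minor (jacobian g x).
by rewrite rk => -[f [h /eqP fh]] /(_ f h).
Qed.

(** The row spaces at [x] and [t *: x] agree, by scaling with [t] and with its inverse, and have
    dimension exactly [n - d] by regularity and the chain bound. Hence [t *: x] is regular and [u]
    is conormal there. *)
Lemma scaled_pair_ED n (X : 'rV[C]_n -> Prop) d k (g : 'I_k -> {mpoly C[n]}) x u t :
  irreducible X -> has_chain X d -> generates g (vanishing X) -> affine_cone X ->
  Xreg (n - d) X g x -> (forall v, tangent g x v -> bil u v = 0) -> t != 0 ->
  ED_corr_pts (n - d) X g (row_mx (u + t *: x) (t *: x)).
Proof.
move=> irrX chX gen cone rx /orthogonal_tangentP ux t0.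
have gX i : vanishing X (g i) by exact: generators_vanish.
have Xx := rx.1.
have rkx : \rank (jacobian g x) = (n - d)%N.
  have := jacobian_rank_chain irrX chX gX Xx; have := reg_rank rx; lia.
have xE : x = t^-1 *: (t *: x) by rewrite scalerA mulVf // scale1r.
have xtx : (jacobian g x <= jacobian g (t *: x))%MS.
  by rewrite {1}xE; apply: (jacobian_scale_sub gen cone); rewrite ?invr_eq0 //; apply: cone.
have rktx : \rank (jacobian g (t *: x)) = (n - d)%N.
  apply/eqP; rewrite -rkx eqn_leq !mxrankS //.
  exact: jacobian_scale_sub gen cone Xx t0.
rewrite /ED_corr_pts row_mxKl row_mxKr addrK; split; first exact: rank_reg (cone _ _ Xx) rktx.
by rewrite -rktx mxrankS // col_mx_sub (submx_trans ux xtx) submx_refl.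
Qed.

(** At a regular point the Jacobian has rank at least [c], so bordering it without exceeding rank
    [c] leaves the row space unchanged. *)
Lemma ED_corr_conormal n (X : 'rV[C]_n -> Prop) c k (g : 'I_k -> {mpoly C[n]}) z :
  ED_corr_pts c X g z -> conormal_pts c X g (lsubmx z - rsubmx z).
Proof.
move=> [rz rk]; exists (rsubmx z); split=> //; apply/orthogonal_tangentP.
set J := jacobian _ _ in rk *; have JD : (J <= col_mx (lsubmx z - rsubmx z) J)%MS.
  by rewrite -addsmxE addsmxSr.
have /andP[_ ] : (J == col_mx (lsubmx z - rsubmx z) J)%MS.
  rewrite -(geq_leqif (mxrank_leqif_eq JD)).
  exact: leq_trans rk (reg_rank rz).
by rewrite col_mx_sub => /andP [].
Qed.

End Geometry.

Theorem theorem2p1 (R : realType) (n : nat) (X : 'rV[R[i]]_n -> Prop)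
  (d : nat) (k : nat) (g : 'I_k -> {mpoly R[i][n]}) :
  irreducible X ->
  dimension X d ->
  generates g (vanishing X) ->
  affine_cone X ->
  ~ linear_subspace X ->
  let c := (n - d)%N in
  (forall u, dual_variety c X g u -> DS c X g u) /\
  (forall u, DS c X g u ->
     exists a b, dual_variety c X g a /\ Sing c X g b /\ u = a + b).
Proof.
move=> irrX dimX gen cone nlin c.
have S0 : Sing c X g 0 by exact: zero_singular.
split=> [u dual_u|u [x [ux Sx]]].
- exists 0; split=> //.
  (* [T] encodes the polynomial map from [u] to the pair [(u, 0)]. Equations pull back along it, so
     only conormal vectors at regular points need be treated, not their limits. *)
  pose T : (n + n).-tuple {mpoly R[i][n]} :=
    [tuple if split l is inl j then 'X_j else 0 | l < n + n].
  have TE y : \row_l evalpt (tnth T l) y = row_mx y 0.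
    apply/rowP => l; rewrite !mxE tnth_mktuple /evalpt.
    by case: split => j; rewrite ?mevalXU // meval0 mxE.
  rewrite /ED_corr -TE; apply: zclosure_image dual_u => {}u [x [rx ux]].
  rewrite TE; apply: (zclosure_limit (b := row_mx x x)) => t t0.
  rewrite scale_row_mx add_row_mx add0r.
  exact: scaled_pair_ED irrX dimX.1 gen cone rx ux t0.
exists (u - x), x; split; last by rewrite subrK.
pose T : n.-tuple {mpoly R[i][n + n]} :=
  [tuple 'X_(lshift n l) - 'X_(rshift n l) | l < n].
have TE z : \row_l evalpt (tnth T l) z = lsubmx z - rsubmx z.
  by apply/rowP => l; rewrite !mxE tnth_mktuple /evalpt mevalB !mevalXU.
have -> : u - x = \row_l evalpt (tnth T l) (row_mx u x).
  by rewrite TE row_mxKl row_mxKr.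
apply: zclosure_image ux => z zED; rewrite TE => p; apply.
exact: ED_corr_conormal.
Qed.
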